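(* Let $n\ge2$, $0<a\le1$, let $G$ be the free group on $u_1,\dots,u_n$, and let $\pi$ be the unitary representation of $G$ on $H$, with vector $\Delta_1\in H$, constructed in the context from $\phi(s)=a^{|s|-2\gamma(s)}b^{\gamma(s)}$, $b=\frac{na^2-1}{n-1}$. Then the only eigenvalue of $\pi(u_1)+\cdots+\pi(u_n)$ is $na$, and the corresponding eigenspace consists of the scalar multiples of $\Delta_1$.
   Context: For $s\in G$ (a reduced word in $u_1^{\pm1},\dots,u_n^{\pm1}$), $|s|$ is its length and $\gamma(s)$ is the number of positions where a letter $u_i^{-1}$ is immediately followed by a letter $u_j$. Convention $0^0=1$. $G^+$ is the unital subsemigroup of $G$ generated by $u_1,\dots,u_n$. Construction of $\pi$. $H_0$ is the Hilbert space that is the closed linear span of vectors $\{\Delta_s:s\in G^+\}$ satisfying $\langle\Delta_t,\Delta_s\rangle=\phi(s^{-1}t)$ and $\sum_{i=1}^n\Delta_{su_i}=na\,\Delta_s$ for $s,t\in G^+$. (It exists because the matrices $(\phi(s^{-1}t))_{s,t}$ indexed by the words of length $k$ in $G^+$ are positive semidefinite for every $k$, and $\sum_i\phi(xu_i)=na\,\phi(x)=\sum_i\phi(u_i^{-1}x)$ for $x\in G$; it is the inductive limit of the finite-dimensional spaces $E_k$ spanned by $\Delta_s$, $s\in G^+$, $|s|=k$, under the isometries $\Delta_s\mapsto(na)^{-1}\sum_i\Delta_{su_i}$.) For each $i$, $V_i$ is the isometry of $H_0$ with $V_i\Delta_s=\Delta_{u_is}$, and $H_i'=H_0\ominus V_iH_0$.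 $S_i^-\subset G$ is the set of reduced words whose last letter is $u_i^{-1}$, with $\{\delta_s\}$ the standard orthonormal basis of $\ell^2(S_i^-)$. Put $$H=H_0\oplus\bigoplus_{i=1}^n\bigl(\ell^2(S_i^-)\otimes H_i'\bigr).$$ For each $i$, $U_i$ is the unitary on $H$ which equals $V_i$ on $H_0$, sends $\delta_{u_i^{-1}}\otimes\eta$ to $\eta\in H_i'\subset H_0$ for $\eta\in H_i'$, and sends $\delta_s\otimes\eta$ to $\delta_{u_is}\otimes\eta$ for all other $s\in\bigcup_jS_j^-$ (with $\eta\in H_j'$ when $s\in S_j^-$). $\pi$ is the unitary representation of $G$ on $H$ with $\pi(u_i)=U_i$. *)

(* Defs.v *)
From HB Require Import structures.
From mathcomp Require Import all_boot all_order all_algebra.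
From mathcomp Require Import sesquilinear complex.
From mathcomp Require Import all_classical all_reals all_analysis.
Import Order.TTheory GRing.Theory Num.Theory.
Import numFieldNormedType.Exports.
Set Implicit Arguments.
Unset Strict Implicit.
Unset Printing Implicit Defensive.
Local Open Scope classical_set_scope.
Local Open Scope complex_scope.
Local Open Scope ring_scope.

(* (i, true) encodes the letter u_i and (i, false) the letter u_i^-1. *)
Notation letter n := ('I_n * bool)%type.

Definition inv_letter n (l : letter n) : letter n := (l.1, ~~ l.2).

Definition reduced n (w : seq (letter n)) : bool :=
  sorted (fun l m => m != inv_letter l) w.

Definition push n (l : letter n) (w : seq (letter n)) : seq (letter n) :=
  if w is m :: w' then if m == inv_letter l then w' else l :: w else [:: l].

(* The reduced form of v ++ w, for w reduced. *)
Definition act_word n (v w : seq (letter n)) : seq (letter n) :=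
  foldr (@push n) w v.

Lemma inv_letterK n : involutive (@inv_letter n).
Proof. by case=> i b; rewrite /inv_letter /= negbK. Qed.

Lemma reduced_behead n l (w : seq (letter n)) : reduced (l :: w) -> reduced w.
Proof. by rewrite /reduced; case: w => //= m w /andP[]. Qed.

Lemma push_reduced n l (w : seq (letter n)) : reduced w -> reduced (push l w).
Proof.
case: w => [//|m w] rw /=; case: ifPn => [_|ne]; first exact: reduced_behead rw.
by rewrite /reduced /= ne.
Qed.

Lemma act_word_reduced n (v w : seq (letter n)) :
  reduced w -> reduced (act_word v w).
Proof. by move=> rw; elim: v => //= l v; apply: push_reduced. Qed.

Lemma pushK n l (w : seq (letter n)) :
  reduced w -> push (inv_letter l) (push l w) = w.
Proof.
case: w => [|m w] rw /=; first by rewrite inv_letterK eqxx.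
case: eqP => [em|_] /=; last by rewrite inv_letterK eqxx.
case: w rw => [|p w] /= rw; first by rewrite em.
move: rw; rewrite /reduced /= => /andP[npm _].
by rewrite -em (negPf npm).
Qed.

Lemma act_word_push n l (v w : seq (letter n)) :
  reduced w -> act_word (push l v) w = push l (act_word v w).
Proof.
move=> rw; case: v => [//|m v] /=; case: eqP => [->|//].
have := pushK (inv_letter l) (act_word_reduced v rw).
by rewrite inv_letterK => ->.
Qed.

Lemma act_word_act n (v v' w : seq (letter n)) :
  reduced w -> act_word (act_word v v') w = act_word v (act_word v' w).
Proof. by move=> rw; elim: v => //= l v IH; rewrite act_word_push // IH. Qed.

Lemma act_word_id n (w : seq (letter n)) : reduced w -> act_word w [::] = w.
Proof.
elim: w => //= l w IH rw; rewrite IH; last exact: reduced_behead rw.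
by move: rw; rewrite /reduced; case: w {IH} => //= m w /andP[/negPf ->].
Qed.

Definition inv_word n (w : seq (letter n)) : seq (letter n) :=
  rev (map (@inv_letter n) w).

Lemma inv_wordK n : involutive (@inv_word n).
Proof.
by move=> w; rewrite /inv_word map_rev revK mapK //; exact: inv_letterK.
Qed.

Lemma inv_word_reduced n (w : seq (letter n)) :
  reduced w -> reduced (inv_word w).
Proof.
rewrite /reduced /inv_word rev_sorted sorted_map; apply: sub_sorted => l m.
by rewrite /= inv_letterK eq_sym.
Qed.

Lemma act_word_inv n (w : seq (letter n)) :
  reduced w -> act_word (inv_word w) w = [::].
Proof.
elim: w => //= l w IH rlw; have rw := reduced_behead rlw.
rewrite /inv_word /= rev_cons -cats1 /act_word foldr_cat /=.
by rewrite inv_letterK eqxx; exact: IH.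
Qed.

Record freegroup (n : nat) := FreeGroup {
  fgword :> seq (letter n);
  fgword_reduced : reduced fgword
}.

HB.instance Definition _ n := [isSub for @fgword n].
HB.instance Definition _ n := [Countable of freegroup n by <:].

Definition fg_one n : freegroup n := @FreeGroup n [::] isT.
Definition fg_mul n (s t : freegroup n) : freegroup n :=
  FreeGroup (act_word_reduced s (fgword_reduced t)).
Definition fg_inv n (s : freegroup n) : freegroup n :=
  FreeGroup (inv_word_reduced (fgword_reduced s)).

Lemma fg_mulA n : associative (@fg_mul n).
Proof.
move=> x y z; apply/val_inj => /=.
by rewrite act_word_act // fgword_reduced.
Qed.

Lemma fg_mul1g n : left_id (fg_one n) (@fg_mul n).
Proof. by move=> x; apply/val_inj. Qed.

Lemma fg_mulg1 n : right_id (fg_one n) (@fg_mul n).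
Proof. by move=> x; apply/val_inj; rewrite /= act_word_id ?fgword_reduced. Qed.

Lemma fg_mulVg n : left_inverse (fg_one n) (@fg_inv n) (@fg_mul n).
Proof.
by move=> x; apply/val_inj; rewrite /= act_word_inv ?fgword_reduced.
Qed.

Lemma fg_mulgV n : right_inverse (fg_one n) (@fg_inv n) (@fg_mul n).
Proof.
move=> x; apply/val_inj; rewrite /= -{1}(inv_wordK x) act_word_inv //.
exact/inv_word_reduced/fgword_reduced.
Qed.

HB.instance Definition _ n := isGroup.Build (freegroup n)
  (@fg_mulA n) (@fg_mul1g n) (@fg_mulg1 n) (@fg_mulVg n) (@fg_mulgV n).

Definition gen n (i : 'I_n) : freegroup n := @FreeGroup n [:: (i, true)] isT.

Inductive in_Gplus n : freegroup n -> Prop :=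
| Gplus_one : in_Gplus 1%g
| Gplus_gen i : in_Gplus (gen i)
| Gplus_mul s t : in_Gplus s -> in_Gplus t -> in_Gplus (s * t)%g.

Definition Gplus n : set (freegroup n) := [set s | in_Gplus s].

(* S_i^-: the reduced words whose last letter is u_i^-1. *)
Definition Sminus n (i : 'I_n) : set (freegroup n) :=
  [set s : freegroup n | suffix [:: (i, false)] (fgword s)].

Definition fglen n (s : freegroup n) : nat := size s.

Definition fggamma n (s : freegroup n) : nat :=
  count (fun p : letter n * letter n => ~~ p.1.2 && p.2.2) (zip s (behead s)).

(* The positions counted by gamma do not overlap, so 2 * gamma s <= |s| and the
   subtraction is not truncated. The convention 0 ^ 0 = 1 is that of ^+. *)
Definition phi (R : realType) n (a : R) (s : freegroup n) : R :=
  let b := (n%:R * a ^+ 2 - 1) / (n%:R - 1) in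
  a ^+ (fglen s - 2 * fggamma s) * b ^+ fggamma s.

(* The inner product is linear in its first argument. *)
Record hilbert (R : realType) := Hilbert {
  hcarrier :> completeNormedModType R[i];
  hdot : {dot hcarrier for Num.Def.conjC};
  hnormE : forall x, `|x| ^+ 2 = hdot x x
}.

Notation "''[' x , y ]" := (hdot _ x y) : ring_scope.

Section Hilbert.
Variable R : realType.
Implicit Types H K : hilbert R.

Definition lin_span H (A : set H) : set H :=
  [set x | exists (m : nat) (c : 'I_m -> R[i]) (v : 'I_m -> H),
     (forall k, A (v k)) /\ x = \sum_(k < m) c k *: v k].

Definition closed_span H (A : set H) : set H := closure (lin_span A).

Definition is_isometry H K (f : {linear H -> K}) : Prop :=
  forall x y, '[f x, f y] = '[x, y].

Definition unitary_op H (f : {linear H -> H}) : Prop :=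
  is_isometry f /\ (forall y, exists x, f x = y).

Definition unitary_rep (G : groupType) H (pi : G -> {linear H -> H}) : Prop :=
  [/\ forall s, unitary_op (pi s),
      forall x, pi 1%g x = x &
      forall s t x, pi (s * t)%g x = pi s (pi t x)].

Definition eigenspace_of H (T : H -> H) (l : R[i]) : set H :=
  [set x | T x = l *: x].

Definition is_eigenvalue H (T : H -> H) (l : R[i]) : Prop :=
  exists2 x, x != 0 & eigenspace_of T l x.

End Hilbert.

Section Construction.
Variables (R : realType) (n : nat) (a : R).
Local Notation G := (freegroup n).

(* The values of Delta outside G^+ play no role. *)
Record is_H0 (H0 : hilbert R) (Delta : G -> H0) : Prop := {
  Delta_dot : forall s t, Gplus s -> Gplus t ->
    '[Delta t, Delta s] = (phi a (s^-1 * t)%g)%:C;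
  Delta_sum : forall s, Gplus s ->
    \sum_(i < n) Delta (s * gen i)%g = (n%:R * a)%:C *: Delta s;
  Delta_total : closed_span [set Delta s | s in @Gplus n] = setT
}.

Record is_V (H0 : hilbert R) (Delta : G -> H0)
    (V : 'I_n -> {linear H0 -> H0}) : Prop := {
  V_isometry : forall i, is_isometry (V i);
  V_Delta : forall i s, Gplus s -> V i (Delta s) = Delta (gen i * s)%g
}.

(* H_i' = H_0 (-) V_i H_0; the range of the isometry V_i is already closed. *)
Definition Hprime (H0 : hilbert R) (V : 'I_n -> {linear H0 -> H0}) (i : 'I_n) :
  set H0 := [set eta | forall x, '[eta, V i x] = 0].

(* H is the Hilbert direct sum of H_0 and of the l^2(S_i^-) (x) H_i', presented
   by its embeddings: iota is that of H_0, and tens s eta is the elementary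
   tensor delta_s (x) eta, for s in S_i^- and eta in H_i' (other values of tens
   play no role). The sets S_i^- are pairwise disjoint, so s determines i. *)
Record is_H (H0 : hilbert R) (V : 'I_n -> {linear H0 -> H0}) (H : hilbert R)
    (iota : {linear H0 -> H}) (tens : G -> H0 -> H) : Prop := {
  iota_isometry : is_isometry iota;
  tens_linear : forall i s, Sminus i s -> forall c eta zeta,
    Hprime V i eta -> Hprime V i zeta ->
    tens s (c *: eta + zeta) = c *: tens s eta + tens s zeta;
  tens_dot : forall i j s t eta zeta, Sminus i s -> Sminus j t ->
    Hprime V i eta -> Hprime V j zeta ->
    '[tens s eta, tens t zeta] = (s == t)%:R * '[eta, zeta];
  tens_iota : forall i s eta x, Sminus i s -> Hprime V i eta ->
    '[tens s eta, iota x] = 0;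
  H_total : closed_span
    (range iota `|`
     [set y | exists i s eta, [/\ Sminus i s, Hprime V i eta & y = tens s eta]])
    = setT
}.

Record is_U (H0 : hilbert R) (V : 'I_n -> {linear H0 -> H0}) (H : hilbert R)
    (iota : {linear H0 -> H}) (tens : G -> H0 -> H)
    (U : 'I_n -> {linear H -> H}) : Prop := {
  U_unitary : forall i, unitary_op (U i);
  U_iota : forall i x, U i (iota x) = iota (V i x);
  U_tens_inv : forall i eta, Hprime V i eta ->
    U i (tens (gen i)^-1%g eta) = iota eta;
  U_tens : forall i j s eta, Sminus j s -> Hprime V j eta ->
    s != (gen i)^-1%g -> U i (tens s eta) = tens (gen i * s)%g eta
}.

End Construction.

(* Main.v *)
(** Let [x] be an eigenvector for [l].

    For [eta] in [H_j'] the coefficients [f w = <x, delta_w (x) eta>], for [w]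
    in [S_j^-], are square summable and satisfy
    [l * f w = \sum_i f (u_i^-1 w)]. View [S_j^-] as a rooted tree in which the
    children of [w] are the reduced words [u w], [u] a letter. When [|l|^2 < n],
    the potential
      [psi w = v w * |f w|^2 + kappa * \sum_i |f (u_i^-1 w)|^2],
    where [v w] is the number of children [u_k w] and
    [kappa = n (n - 1) / (n - |l|^2)], is at most the sum of its values at the
    children of [w]; when [|l|^2 >= n] the second sum alone has this property.
    Such a potential has nondecreasing level sums, so summability forces it to
    vanish. Hence [f = 0] and [x] lies in the closure of the copy of [H_0].

    On [H_0] one has [V_i^* V_k = b <., Delta_1> Delta_1] for [i != k], and
    [V_i^* Delta_1 = a Delta_1]. So [z = x - <x, Delta_1> Delta_1] is again an
    eigenvector for [l], and [l * <z, Delta_(u_i s)> = <z, Delta_s>]; as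
    [<z, Delta_1> = 0], this gives [z = 0]. *)

Require Import Defs.
From mathcomp Require Import all_boot all_order all_algebra.
From mathcomp Require Import sesquilinear complex.
From mathcomp Require Import ring lra.
From mathcomp Require Import all_classical all_reals all_analysis.
Import Order.TTheory GRing.Theory Num.Theory.
Import numFieldNormedType.Exports.
Set Implicit Arguments.
Unset Strict Implicit.
Unset Printing Implicit Defensive.
Local Open Scope classical_set_scope.
Local Open Scope complex_scope.
Local Open Scope ring_scope.

(** Cauchy-Schwarz against the constant 1: sum [2 * (x i * x j) <= x i ^+ 2 + x j ^+ 2] over all
    pairs. *)
Lemma sqr_sum_le (R : realFieldType) (I : finType) (P : pred I) (x : I -> R) :
  (\sum_(i | P i) x i) ^+ 2 <= #|P|%:R * \sum_(i | P i) x i ^+ 2.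
Proof.
suff : 2 * (\sum_(i | P i) x i) ^+ 2 <= 2 * (#|P|%:R * \sum_(i | P i) x i ^+ 2).
  by rewrite ler_pM2l.
have -> : 2 * (\sum_(i | P i) x i) ^+ 2 =
    \sum_(i | P i) \sum_(j | P j) 2 * (x i * x j).
  rewrite expr2 big_distrlr /= mulr_sumr; apply: eq_bigr => i _.
  by rewrite mulr_sumr.
have -> : 2 * (#|P|%:R * \sum_(i | P i) x i ^+ 2) =
    \sum_(i | P i) \sum_(j | P j) (x i ^+ 2 + x j ^+ 2).
  under [RHS]eq_bigr => i _ do rewrite big_split /= sumr_const.
  by rewrite big_split /= sumr_const sumrMnl -mulr_natl; ring.
apply: ler_sum => i _; apply: ler_sum => j _.
by have := sqr_ge0 (x i - x j); nra.
Qed.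

Lemma bounded_multiples_le0 (R : realType) (x C : R) :
  (forall N : nat, N%:R * x <= C) -> x <= 0.
Proof.
move=> h; rewrite leNgt; apply/negP => x0.
have := h (Num.bound (C / x)); apply/negP; rewrite -ltNge -ltr_pdivrMr //.
apply: archi_boundP; rewrite divr_ge0 ?(ltW x0) //.
by have := h 0; rewrite mul0r.
Qed.

(** * Words as a rooted tree, and summable subharmonic functions on it *)

Section Words.
Variable n : nat.
Local Notation word := (seq (letter n)).

(** Words of length at most [N], unreduced ones included, so that [w ++ s] runs through the first
    levels of the full tree rooted at [s]. *)
Fixpoint words_below (N : nat) : seq word :=
  if N is N'.+1 then
    [::] :: [seq l :: w | l <- enum {: letter n}, w <- words_below N']
  else [::].

Lemma words_below_uniq N : uniq (words_below N).
Proof.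
elim: N => //= N IH; apply/andP; split.
  by apply/negP => /allpairsP[[l w]] [].
apply: allpairs_uniq => //; first exact: enum_uniq.
by move=> [l w] [l' w'] _ _ /= [-> ->].
Qed.

Lemma sum_words_belowS (R : nmodType) (h : word -> R) N s :
  \sum_(w <- words_below N.+1) h (w ++ s) =
  h s + \sum_(w <- words_below N) \sum_l h (l :: w ++ s).
Proof.
rewrite /= big_cons big_allpairs_dep /=; congr (_ + _).
by rewrite exchange_big; apply: eq_bigr => w _; rewrite big_enum.
Qed.

Lemma sum_letter (R : nmodType) (F : letter n -> R) :
  \sum_l F l = \sum_i F (i, true) + \sum_i F (i, false).
Proof.
rewrite -big_split /=; transitivity (\sum_i \sum_b F (i, b)).
  by rewrite pair_bigA /=; apply: eq_bigr => -[].
by apply: eq_bigr => i _; rewrite big_bool.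
Qed.

(** Each level of the tree rooted at [s] has [psi]-sum at least [psi s], while domination by [G]
    bounds the sum over any number of levels by [c * (C + C)]: a value of [G] enters at most once as
    a node and once as a child. *)
Lemma subharmonic_summable_eq0 (R : realType) (psi G : word -> R) (c C : R) :
  0 <= c ->
  (forall w, 0 <= psi w) -> (forall w, 0 <= G w) ->
  (forall w, psi w <= \sum_l psi (l :: w)) ->
  (forall w, psi w <= c * (G w + \sum_l G (l :: w))) ->
  (forall L : seq word, uniq L -> \sum_(w <- L) G w <= C) ->
  forall s, psi s = 0.
Proof.
move=> c0 psi0 G0 sub dom bnd s; apply/eqP; rewrite eq_le psi0 andbT.
apply: (@bounded_multiples_le0 _ _ (c * (C + C))) => N.
have Gbnd M : \sum_(w <- words_below M) G (w ++ s) <= C.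
  rewrite -(big_map (cat^~ s) xpredT G); apply: bnd.
  rewrite map_inj_uniq; first exact: words_below_uniq.
  move=> u v /(congr1 (fun t => take (size t - size s) t)).
  by rewrite !size_cat !addnK !take_size_cat.
have lower M : M%:R * psi s <= \sum_(w <- words_below M) psi (w ++ s).
  elim: M => [|M IH]; first by rewrite mul0r big_nil.
  rewrite sum_words_belowS -natr1 mulrDl mul1r [leLHS]addrC lerD2l.
  by apply: le_trans IH _; apply: ler_sum => w _; exact: sub.
apply: le_trans (lower N) _.
apply: (@le_trans _ _ (\sum_(w <- words_below N)
    c * (G (w ++ s) + \sum_l G (l :: w ++ s)))).
  by apply: ler_sum => w _; exact: dom.
rewrite -mulr_sumr ler_wpM2l // big_split /= lerD ?Gbnd //.
apply: le_trans (Gbnd N.+1).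
by rewrite sum_words_belowS lerDr.
Qed.

Definition live (j : 'I_n) : pred word :=
  [pred w | reduced w && suffix [:: (j, false)] w].

Lemma suffix1_cons (T : eqType) (x y : T) (s : seq T) :
  suffix [:: x] (y :: s) = (x == last y s).
Proof. by rewrite (lastI y) (suffix_rcons [::]) suffix0s andbT. Qed.

Lemma live_behead j i w : live j ((i, true) :: w) -> live j w.
Proof.
case: w => [|m w]; first by rewrite /live /= suffix1_cons /= xpair_eqE andbF.
by rewrite /live /reduced /= !suffix1_cons /= => /andP[/andP[_ ->] ->].
Qed.

Lemma live_cons j l m w :
  live j (l :: m :: w) = (m != inv_letter l) && live j (m :: w).
Proof. by rewrite /live /= !suffix1_cons /reduced /= andbA. Qed.

Lemma liveP j w : live j w ->
  exists2 s : freegroup n, fgword s = w & Sminus j s.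
Proof. by case/andP => rw sw; exists (FreeGroup rw). Qed.

(** Only a leading positive letter can cancel, so the final [u_j^-1] survives. Hence the eigenvalue
    equation stays within S_j^-. *)
Lemma live_push_neg j i w : live j w -> live j (push (i, false) w).
Proof.
move=> dw; case: w dw => [|[k c] w] dw; first by rewrite /live /= in dw.
rewrite /= -[inv_letter _]/(i, true) xpair_eqE; case: c dw => dw.
  rewrite eqxx andbT; case: (k =P i) => [_|/eqP ki].
    exact: live_behead dw.
  by rewrite live_cons dw -[inv_letter _]/(i, true) xpair_eqE (negPf ki).
by rewrite andbF live_cons dw -[inv_letter _]/(i, true) xpair_eqE andbF.
Qed.

(** * Vanishing of square-summable solutions of the eigenvalue inequalities *)

Section Decay.
Variables (R : realType) (j : 'I_n) (g : word -> R) (L C : R).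
Hypothesis n_gt1 : (1 < n)%N.
Hypothesis L_ge0 : 0 <= L.
Hypothesis g_ge0 : forall w, 0 <= g w.
Hypothesis g_dead : forall w, ~~ live j w -> g w = 0.
(** With [g = |f|] and [L = |l|], these are triangle inequalities in the eigenvalue equation of [f];
    for [g_back] the equation is first solved for [f w]. *)
Hypothesis g_neg : forall i w, live j ((i, false) :: w) ->
  L * g ((i, false) :: w) <= \sum_k g [:: (k, false), (i, false) & w].
Hypothesis g_pos : forall i w, live j ((i, true) :: w) ->
  L * g ((i, true) :: w) <=
  g w + \sum_(k | k != i) g [:: (k, false), (i, true) & w].
Hypothesis g_back : forall i w, live j ((i, true) :: w) ->
  g w <=
  L * g ((i, true) :: w) + \sum_(k | k != i) g [:: (k, false), (i, true) & w].
Hypothesis g_summable :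
  forall s : seq word, uniq s -> \sum_(w <- s) g w ^+ 2 <= C.

Let n_gt0 : (0 : R) < n%:R.
Proof. by rewrite ltr0n ltnW. Qed.

Lemma neg_mass w i : live j ((i, false) :: w) ->
  L ^+ 2 * g ((i, false) :: w) ^+ 2 <=
  n%:R * \sum_k g [:: (k, false), (i, false) & w] ^+ 2.
Proof.
pose f k := g [:: (k, false), (i, false) & w].
have f_ge0 k : 0 <= f k by exact: g_ge0.
move=> dw; rewrite -exprMn; apply: le_trans (_ : (\sum_k f k) ^+ 2 <= _).
  by rewrite ler_pXn2r ?nnegrE ?g_neg ?mulr_ge0 ?sumr_ge0.
by have := sqr_sum_le xpredT f; rewrite cardT size_enum_ord.
Qed.

(** By [neg_mass] the squares over negative children form a subharmonic potential. Once these
    vanish, [g_pos] reads [L * g (u_i w) <= g w], and induction starts at the empty word, which is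
    not live. *)
Lemma decay_fast : n%:R <= L ^+ 2 -> forall w, g w = 0.
Proof.
move=> Lbig.
have L0 : L != 0.
  by apply: contraTneq Lbig => ->; rewrite expr0n -ltNge.
pose psi w := \sum_k g ((k, false) :: w) ^+ 2.
have psi0 w : 0 <= psi w by apply: sumr_ge0 => k _; rewrite sqr_ge0.
have psiE : forall w, psi w = 0.
  apply: (@subharmonic_summable_eq0 _ _ (fun w => g w ^+ 2) 1 C) => //.
  - by move=> w; rewrite sqr_ge0.
  - move=> w; rewrite sum_letter ler_wpDl ?sumr_ge0 //.
    apply: ler_sum => i _.
    have [dw|/g_dead->] := boolP (live j ((i, false) :: w)); last first.
      by rewrite expr0n.
    have := neg_mass dw; rewrite -/(psi _) => h.
    rewrite -(ler_pM2l n_gt0); apply: le_trans h.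
    by rewrite ler_wpM2r ?sqr_ge0.
  - move=> w; rewrite mul1r sum_letter addrA ler_wpDl //.
    by rewrite addr_ge0 ?sqr_ge0 ?sumr_ge0 // => i _; rewrite sqr_ge0.
have neg0 i w : g ((i, false) :: w) = 0.
  apply/eqP; rewrite -sqrf_eq0; move/eqP: (psiE w).
  rewrite psumr_eq0 => [|k _]; last exact: sqr_ge0.
  by move/allP/(_ i (mem_index_enum _)).
elim=> [|[i [] ] w IH] //.
  by apply: g_dead; rewrite /live /= /suffix.
have [dw|/g_dead //] := boolP (live j ((i, true) :: w)).
have := g_pos dw; rewrite IH big1 // addr0 => h.
apply/eqP; rewrite eq_le g_ge0 andbT -(ler_pM2l (_ : 0 < L)) ?mulr0 //.
by rewrite lt_neqAle eq_sym L0.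
Qed.

Lemma decay_slow : L ^+ 2 < n%:R -> forall w, g w = 0.
Proof.
move=> Lsmall.
have nL : 0 < n%:R - L ^+ 2 by rewrite subr_gt0.
have n1 : 0 < n%:R - 1 :> R by rewrite subr_gt0 ltr1n.
(* This value solves [kappa = (n - 1) + kappa * L^2 / n], the balance that [side] requires. *)
pose kappa := n%:R * (n%:R - 1) / (n%:R - L ^+ 2).
have kappa0 : 0 <= kappa by rewrite divr_ge0 ?mulr_ge0 // ltW.
pose v w := #|[pred k | live j ((k, true) :: w)]|.
pose psi w := (v w)%:R * g w ^+ 2 + kappa * \sum_k g ((k, false) :: w) ^+ 2.
have ss0 w : 0 <= \sum_k g ((k, false) :: w) ^+ 2.
  by apply: sumr_ge0 => k _; rewrite sqr_ge0.
have psi0 w : 0 <= psi w.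
  by apply: addr_ge0; apply: mulr_ge0; rewrite ?sqr_ge0.
have vpos i w : live j ((i, true) :: w) -> v ((i, true) :: w) = n.
  move=> dw; rewrite -[RHS]card_ord; apply: eq_card => k.
  by rewrite !inE live_cons dw /inv_letter /= xpair_eqE andbF.
have vneg i w : live j ((i, false) :: w) -> v ((i, false) :: w) = n.-1.
  move=> dw; rewrite -[n in RHS]card_ord (cardD1 i) /=; apply: eq_card => k.
  rewrite !inE live_cons dw andbT /inv_letter /= xpair_eqE.
  by rewrite andbT eq_sym andbT.
have vge w : live j w -> (n.-1 <= v w)%N.
  case: w => [|[i [] ] w] dw; first by rewrite /live /= /suffix in dw.
    by rewrite vpos ?leq_pred.
  by rewrite vneg.
have nB1 : (n.-1)%:R = n%:R - 1 :> R by rewrite -subn1 natrB // ltnW.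
have up i w : live j ((i, true) :: w) -> g w ^+ 2 <= psi ((i, true) :: w).
  move=> dw; rewrite /psi vpos //.
  set x := g (_ :: w); set Z := \sum_k _.
  set Y := \sum_(k | k != i) g [:: (k, false), (i, true) & w].
  have Y0 : 0 <= Y by apply: sumr_ge0.
  have hY : Y ^+ 2 <= (n%:R - 1) * Z.
    have := sqr_sum_le (predC1 i) (fun k => g [:: (k, false), (i, true) & w]).
    rewrite cardC1 card_ord nB1 => /le_trans; apply.
    rewrite ler_wpM2l ?(ltW n1) // /Z [leRHS](bigD1 i) //=.
    by rewrite ler_wpDl ?sqr_ge0.
  have hg : g w ^+ 2 <= (L * x + Y) ^+ 2.
    by rewrite ler_pXn2r ?nnegrE ?g_back ?addr_ge0 ?mulr_ge0 ?g_ge0.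
  (* The weights of [x] and [Y] come from completing a square:
     [n x^2 + n Y^2 / (n - L^2) - (L x + Y)^2
      = ((n - L^2) x - L Y)^2 / (n - L^2)]. *)
  apply: le_trans hg _.
  have hk : n%:R / (n%:R - L ^+ 2) * Y ^+ 2 <= kappa * Z.
    have -> : kappa * Z = n%:R / (n%:R - L ^+ 2) * ((n%:R - 1) * Z).
      by rewrite /kappa; ring.
    by rewrite ler_wpM2l // divr_ge0 ?ltW.
  have : 0 <= ((n%:R - L ^+ 2) * x - L * Y) ^+ 2 / (n%:R - L ^+ 2).
    by rewrite divr_ge0 ?sqr_ge0 ?ltW.
  suff -> : ((n%:R - L ^+ 2) * x - L * Y) ^+ 2 / (n%:R - L ^+ 2) =
    n%:R * x ^+ 2 + n%:R / (n%:R - L ^+ 2) * Y ^+ 2 - (L * x + Y) ^+ 2 by lra.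
  by field; rewrite gt_eqF.
have side i w : kappa * g ((i, false) :: w) ^+ 2 <= psi ((i, false) :: w).
  have [dw|/g_dead->] := boolP (live j ((i, false) :: w)); last first.
    by rewrite expr0n mulr0.
  rewrite /psi vneg // nB1.
  have := neg_mass dw; set x := g _ ^+ 2; set Z := \sum_k _ => h.
  have hZ : kappa * (L ^+ 2 / n%:R * x) <= kappa * Z.
    by rewrite ler_wpM2l // mulrAC ler_pdivrMr // (mulrC Z).
  suff -> : kappa * x = (n%:R - 1) * x + kappa * (L ^+ 2 / n%:R * x) by lra.
  by rewrite /kappa; field; rewrite !gt_eqF.
(* The [v w] live positive children each absorb one copy of [g w ^+ 2] by [up]; the negative
   children absorb the [kappa] term by [side]. *)
have sub w : psi w <= \sum_l psi (l :: w).
  rewrite sum_letter {1}/psi lerD //; last by rewrite mulr_sumr ler_sum.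
  rewrite mulr_natl -sumr_const.
  rewrite [leRHS](bigID [pred k | live j ((k, true) :: w)]) /=.
  rewrite ler_wpDr ?sumr_ge0 //; apply: ler_sum => k; exact: up.
have dom w : psi w <= (n%:R + kappa) * (g w ^+ 2 + \sum_l g (l :: w) ^+ 2).
  rewrite sum_letter /psi.
  have : (v w)%:R <= n%:R :> R by rewrite ler_nat -[leqRHS]card_ord max_card.
  have : 0 <= \sum_k g ((k, true) :: w) ^+ 2.
    by apply: sumr_ge0 => k _; rewrite sqr_ge0.
  have := ss0 w; have := sqr_ge0 (g w).
  nra.
have psiE := subharmonic_summable_eq0 (addr_ge0 (ltW n_gt0) kappa0) psi0
  (fun w => sqr_ge0 (g w)) sub dom g_summable.
move=> w; have [dw|/g_dead //] := boolP (live j w).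
(* On a live word [v w >= n - 1 > 0], so the vanishing of the first summand of [psi w] forces
   [g w = 0]. *)
have := psiE w; move/eqP; rewrite paddr_eq0; last 2 first.
- by rewrite mulr_ge0 ?sqr_ge0.
- exact: mulr_ge0.
case/andP; rewrite mulf_eq0 pnatr_eq0 sqrf_eq0 => /orP[|/eqP//] /eqP v0 _.
by have := vge w dw; rewrite v0 leqn0 -subn1 subn_eq0 leqNgt n_gt1.
Qed.

Lemma decay w : g w = 0.
Proof. by case: (leP n%:R (L ^+ 2)) => [/decay_fast|/decay_slow]. Qed.

End Decay.
End Words.

(** * Inner products, Bessel's inequality and density *)

Section HilbertTheory.
Variable R : realType.
Local Notation C := R[i].
Implicit Types H K : hilbert R.

Lemma hdotC H (x y : H) : '[x, y] = Num.Def.conjC '[y, x].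
Proof. by rewrite hermC expr0 mul1r. Qed.

Lemma hdotDr H (x y z : H) : '[x, y + z] = '[x, y] + '[x, z].
Proof. exact: linearDr. Qed.

Lemma hdotBl H (x y z : H) : '[x - y, z] = '[x, z] - '[y, z].
Proof. exact: linearBl. Qed.

Lemma hdotZl H c (x z : H) : '[c *: x, z] = c * '[x, z].
Proof. exact: linearZl_LR. Qed.

Lemma hdotZr H c (x z : H) : '[x, c *: z] = Num.Def.conjC c * '[x, z].
Proof. exact: linearZr_LR. Qed.

Lemma hdot0r H (x : H) : '[x, 0] = 0.
Proof. exact: linear0r. Qed.

Lemma hdot_suml H I r (P : pred I) (E : I -> H) (z : H) :
  '[\sum_(i <- r | P i) E i, z] = \sum_(i <- r | P i) '[E i, z].
Proof. exact: linear_sumlz. Qed.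

Lemma hdot_sumr H I r (P : pred I) (E : I -> H) (z : H) :
  '[z, \sum_(i <- r | P i) E i] = \sum_(i <- r | P i) '[z, E i].
Proof. exact: linear_sumr. Qed.

Lemma hdot_eq0 H (x : H) : '[x, x] = 0 -> x = 0.
Proof. by move/eqP; rewrite dnorm_eq0 => /eqP. Qed.

Lemma CauchySchwarz_hilbert H (x y : H) : `|'[x, y]| <= `|x| * `|y|.
Proof.
have [->|y0] := eqVneq y 0; first by rewrite linear0r !normr0 mulr0.
have yy0 : 0 < '[y, y] by rewrite dnorm_gt0.
rewrite -(@ler_pXn2r _ 2) ?nnegrE ?mulr_ge0 ?normr_ge0 // exprMn !hnormE.
have := dnorm_ge0 (hdot H) ('[y, y] *: x - '[x, y] *: y).
have -> : '['[y, y] *: x - '[x, y] *: y, '[y, y] *: x - '[x, y] *: y] =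
   '[y, y] * ('[x, x] * '[y, y] - `|'[x, y]| ^+ 2).
  rewrite dnormB /= !dnormZ !hdotZl !hdotZr !rmorphM /= conjCK.
  rewrite (geC0_conj (ltW yy0)) (ger0_norm (ltW yy0)) normCK.
  by ring.
by rewrite pmulr_rge0 // subr_ge0.
Qed.

(** The family is not normalised, since it will consist of tensors of common squared norm
    ['[eta, eta]], possibly zero. Cauchy-Schwarz for [x] and its expansion [y] gives
    [m ^+ 2 <= |x|^2 * (m * c)]. *)
Lemma Bessel H (I : eqType) (s : seq I) (e : I -> H) (c : C) (x : H) :
  0 <= c -> uniq s ->
  {in s &, forall i j, '[e i, e j] = (i == j)%:R * c} ->
  \sum_(i <- s) `|'[x, e i]| ^+ 2 <= `|x| ^+ 2 * c.
Proof.
move=> c0 us he; set m := \sum_(i <- s) _.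
have m0 : 0 <= m by apply: sumr_ge0 => i _; rewrite exprn_ge0.
pose y := \sum_(i <- s) '[x, e i] *: e i.
have xy : '[x, y] = m.
  rewrite hdot_sumr; apply: eq_bigr => i _.
  by rewrite hdotZr mulrC -normCK.
have yy : '[y, y] = m * c.
  rewrite hdot_suml mulr_suml big_seq [RHS]big_seq; apply: eq_bigr => i si.
  rewrite hdotZl hdot_sumr (bigD1_seq i) //= big_seq_cond big1 => [|k].
    by rewrite addr0 hdotZr he // eqxx mul1r normCK mulrA.
  by case/andP => sk /negPf ki; rewrite hdotZr he // eq_sym ki mul0r mulr0.
have := CauchySchwarz_hilbert x y.
rewrite -(@ler_pXn2r _ 2) ?nnegrE ?mulr_ge0 ?normr_ge0 // exprMn !hnormE.
rewrite xy yy (ger0_norm m0) -hnormE mulrCA [leLHS]expr2.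
move: m0; rewrite le_eqVlt => /predU1P[<-|m1].
  by rewrite mulr_ge0 ?exprn_ge0.
by rewrite ler_pM2l.
Qed.


Lemma lin_span_ind H (A : set H) (P : H -> Prop) :
  P 0 -> (forall x y, P x -> P y -> P (x + y)) ->
  (forall c x, A x -> P (c *: x)) -> forall x, lin_span A x -> P x.
Proof.
move=> P0 PD PZ _ [m [c [v [Av ->]]]]; elim/big_ind : _ => // k _.
exact/PZ.
Qed.

Lemma closure_dist H (A : set H) (x : H) (e : C) :
  closure A x -> 0 < e -> exists2 y, A y & `|x - y| < e.
Proof.
move=> clA e0; have [y [Ay]] := clA _ (nbhsx_ballx x e e0).
by rewrite -ball_normE /= => ?; exists y.
Qed.

Lemma bounded_eq0 H (F : H -> C) (M : C) (x : H) (A : set H) :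
  {morph F : y z / y - z} -> 0 <= M -> (forall y, `|F y| <= M * `|y|) ->
  (forall y, A y -> F y = 0) ->
  closure A x -> F x = 0.
Proof.
move=> FB M0 bF FA clx.
apply/eqP; rewrite -normr_le0; apply/ler_addgt0Pl => e e0; rewrite addr0.
(* Dividing by [M + 1] also covers [M = 0]. *)
have [|y Ay xy] := closure_dist clx (_ : 0 < e / (M + 1)).
  by rewrite divr_gt0 // ltr_wpDl.
have -> : F x = F (x - y) by rewrite FB (FA y Ay) subr0.
apply: le_trans (bF _) _.
apply: (@le_trans _ _ (M * (e / (M + 1)))).
  by rewrite ler_wpM2l // ltW.
rewrite mulrCA; apply: ler_piMr; first exact: ltW.
by rewrite ler_pdivrMr ?mul1r ?lerDl // ltr_wpDl.
Qed.

End HilbertTheory.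

(** * Positive words and the values of [phi] on them *)

Section PositiveWords.
Variable n : nat.
Local Notation word := (seq (letter n)).
Local Notation G := (freegroup n).

(** Products in [in_Gplus] may split anywhere; carrying an arbitrary right factor [t] through the
    induction reassociates them. *)
Lemma Gplus_ind_left (P : G -> Prop) :
  P 1%g -> (forall i s, Gplus s -> P s -> P (gen i * s)%g) ->
  forall s, Gplus s -> P s.
Proof.
move=> P1 Pg s Gs.
suff : forall t, Gplus t -> P t -> P (s * t)%g.
  by move=> /(_ 1%g (Gplus_one n) P1); rewrite mulg1.
elim: Gs => [t _|i t Gt|u v Gu IHu Gv IHv t Gt Pt]; rewrite ?mul1g //.
  exact: Pg.
by rewrite -mulgA; apply: IHu; [exact: Gplus_mul | exact: IHv].
Qed.

Definition pos_word : pred word := all (fun l => l.2).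
Definition neg_word : pred word := all (fun l => ~~ l.2).

Lemma reduced_cons2 (l m : letter n) (w : word) :
  reduced (l :: m :: w) = (m != inv_letter l) && reduced (m :: w).
Proof. by []. Qed.

Lemma push_pos i (w : word) : pos_word w -> push (i, true) w = (i, true) :: w.
Proof.
by case: w => //= -[k b] w /= /andP[-> _]; rewrite /inv_letter xpair_eqE andbF.
Qed.

Lemma Gplus_pos (s : G) : Gplus s -> pos_word s.
Proof. by elim/Gplus_ind_left => // i t _ pt; rewrite /= push_pos. Qed.

Lemma gen_mul_word i (s : G) :
  Gplus s -> (gen i * s)%g = (i, true) :: s :> word.
Proof. by move=> /Gplus_pos ps; rewrite /= push_pos. Qed.

Lemma act_word_cat (v w : word) : reduced (v ++ w) -> act_word v w = v ++ w.
Proof.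
elim: v => //= l v IH rw; rewrite IH; last exact: reduced_behead rw.
by move: rw; case: (v ++ w) => //= m u /andP[/negPf ->].
Qed.

(** The count of [fggamma] on bare words, so that induction needs no proof of reducedness. *)
Definition gamma_word (w : word) : nat :=
  count (fun p : letter n * letter n => ~~ p.1.2 && p.2.2) (zip w (behead w)).

Lemma gamma_cons2 l m (w : word) :
  gamma_word (l :: m :: w) = (~~ l.2 && m.2 + gamma_word (m :: w))%N.
Proof. by []. Qed.

Lemma gamma_pos (w : word) : pos_word w -> gamma_word w = 0%N.
Proof.
elim: w => // l [//|m w] IH /andP[pl pw]; rewrite gamma_cons2 IH //.
by rewrite pl.
Qed.

(** Letters of opposite sign meet only at [u_i^-1 u_j], where [i != j] rules out cancellation. *)
Lemma reduced_peak (u v : word) i j : i != j -> neg_word u ->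
  pos_word v -> reduced v -> reduced (u ++ (i, false) :: (j, true) :: v).
Proof.
move=> ij nu pv rv; elim: u nu => [_|l u IH /andP[nl nu]].
  rewrite cat0s reduced_cons2 -[inv_letter _]/(i, true) xpair_eqE eqxx andbT.
  rewrite [j == i]eq_sym ij andTb.
  case: v pv rv => // m v /andP[pm _] rv; rewrite reduced_cons2 rv andbT.
  by apply: contraTneq pm => ->.
have {IH} := IH nu; case: u nu => [_|m u /andP[nm _]] rw.
  by rewrite !cat_cons cat0s reduced_cons2 rw /inv_letter xpair_eqE nl andbF.
rewrite !cat_cons reduced_cons2 rw andbT.
by apply: contraNneq nm => ->.
Qed.

Lemma gamma_peak (u v : word) i j : neg_word u -> pos_word v ->
  gamma_word (u ++ (i, false) :: (j, true) :: v) = 1%N.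
Proof.
move=> nu pv; elim: u nu => [_|l u IH /andP[nl nu]].
  rewrite /= gamma_cons2 /= (@gamma_pos ((j, true) :: v)) //.
have {IH} := IH nu; case: u nu => [_|m u /andP[nm _]] gw.
  by rewrite gamma_cons2 gw andbF.
by rewrite gamma_cons2 gw (negPf nm) andbF.
Qed.

Lemma inv_pos_word (w : word) : pos_word w -> neg_word (inv_word w).
Proof.
by rewrite /neg_word all_rev all_map; apply: sub_all => l /= ->.
Qed.

Variables (R : realType) (a : R).
Local Notation b := ((n%:R * a ^+ 2 - 1) / (n%:R - 1)).

Lemma phi_pos (s : G) : Gplus s -> phi a s = a ^+ size s.
Proof.
move=> /Gplus_pos ps; rewrite /phi /fglen /fggamma -/(gamma_word s).
by rewrite gamma_pos // muln0 subn0 expr0 mulr1.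
Qed.

(** The reduced product has length [size s + size t + 2] and a single position counted by gamma. The
    value splits into a factor in [s] and one in [t], which makes V_i^* V_j of rank at most one. *)
Lemma phi_peak i j (s t : G) : i != j -> Gplus s -> Gplus t ->
  phi a ((gen i * s)^-1 * (gen j * t))%g = a ^+ (size s + size t) * b.
Proof.
move=> ij Gs Gt; have ps := Gplus_pos Gs; have pt := Gplus_pos Gt.
have wE : ((gen i * s)^-1 * (gen j * t))%g =
    inv_word s ++ (i, false) :: (j, true) :: t :> word.
  rewrite -[fgword _]/(act_word (inv_word (gen i * s)%g) (gen j * t)%g).
  rewrite !gen_mul_word // /inv_word /= rev_cons -cats1 act_word_cat -catA //=.
  by rewrite reduced_peak ?fgword_reduced //; exact: inv_pos_word.
rewrite /phi /fglen /fggamma -/(gamma_word _) wE gamma_peak ?inv_pos_word //.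
rewrite muln1 expr1 size_cat /= size_rev size_map !addnS.
by rewrite subn2.
Qed.

End PositiveWords.

(** * Complex moduli as real numbers *)

Section Modulus.
Variable R : realType.

(** The norm on [R[i]] is itself [R[i]]-valued, whereas the decay argument concerns functions into
    [R]. *)
Definition modulus (z : R[i]) : R := complex.Re `|z|.

Lemma modulusE z : (modulus z)%:C = `|z|.
Proof. exact: RRe_real (normr_real z). Qed.

Lemma modulus_ge0 z : 0 <= modulus z.
Proof. by rewrite -lecR modulusE; exact: normr_ge0. Qed.

Lemma modulus_eq0 z : modulus z = 0 -> z = 0.
Proof. by move=> z0; apply/normr0_eq0; rewrite -modulusE z0. Qed.

Lemma modulusM z w : modulus (z * w) = modulus z * modulus w.
Proof. by apply/complexI; rewrite rmorphM /= !modulusE normrM. Qed.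

Lemma modulusD z w : modulus (z + w) <= modulus z + modulus w.
Proof. by rewrite -lecR rmorphD /= !modulusE ler_normD. Qed.

Lemma modulusB z w : modulus (z - w) <= modulus z + modulus w.
Proof. by rewrite -lecR rmorphD /= !modulusE ler_normB. Qed.

Lemma modulus_sum (I : finType) (P : pred I) (F : I -> R[i]) :
  modulus (\sum_(i | P i) F i) <= \sum_(i | P i) modulus (F i).
Proof.
rewrite -lecR rmorph_sum modulusE; apply: le_trans (ler_norm_sum _ _ _) _.
by under [leRHS]eq_bigr do rewrite /= modulusE.
Qed.
End Modulus.

Lemma isometry_norm (R : realType) (H K : hilbert R) (f : {linear H -> K}) x :
  is_isometry f -> `|f x| = `|x|.
Proof.
by move=> hf; apply/eqP; rewrite -(@eqrXn2 _ 2) // !hnormE hf.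
Qed.

(** * Eigenvectors of the sum of the [U i] *)

Section Eigen.
Variables (R : realType) (n : nat) (a : R).
Variables (H0 : hilbert R) (Delta : freegroup n -> H0).
Variables (V : 'I_n -> {linear H0 -> H0}).
Variables (H : hilbert R) (iota : {linear H0 -> H}).
Variables (tens : freegroup n -> H0 -> H).
Variables (U : 'I_n -> {linear H -> H}).
Hypothesis n_gt1 : (1 < n)%N.
Hypothesis hH0 : is_H0 a Delta.
Hypothesis hV : is_V Delta V.
Hypothesis hH : is_H V iota tens.
Hypothesis hU : is_U V iota tens U.

Local Notation b := ((n%:R * a ^+ 2 - 1) / (n%:R - 1)).
Local Notation word := (seq (letter n)).

Lemma U_isometry i : is_isometry (U i).
Proof. by case: (U_unitary hU i). Qed.

(** * Coefficients of an eigenvector along the tensors *)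

Section TensorPart.
Variables (x : H) (l : R[i]).
Hypothesis x_eigen : \sum_i U i x = l *: x.
Variables (j : 'I_n) (eta : H0).
Hypothesis eta_in : Hprime V j eta.

(** Extended to unreduced words by the default [fg_one], to live on the word tree; [g] later cuts it
    off outside live words. *)
Let coef (w : word) : R[i] := '[x, tens (insubd (fg_one n) w) eta].

(** Since [U i] is an isometry taking the tensor at [u_i^-1 w] to the one at [w], it moves across
    the inner product. The exceptional index [u_i^-1] of [U_tens] would mean [w = 1]. *)
Lemma coef_eigen w :
  live j w -> l * coef w = \sum_i coef (push (i, false) w).
Proof.
move=> dw; have [t tw St] := liveP dw.
have t1 : t != 1%g by apply: contraTneq St => ->.
rewrite /coef -hdotZl -x_eigen hdot_suml; apply: eq_bigr => i _.
have [t' tw' St'] := liveP (live_push_neg i dw).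
have t'E : t' = ((gen i)^-1 * t)%g by apply/val_inj; rewrite /= tw' tw.
rewrite -tw' -tw !valKd -(U_isometry i x) (U_tens hU St' eta_in).
  by rewrite t'E mulgA mulgV mul1g.
by rewrite t'E -[X in _ != X]mulg1 (inj_eq (mulgI _)).
Qed.

Lemma coef_eq0 s : Sminus j s -> '[x, tens s eta] = 0.
Proof.
move=> Ss; have dw : live j s by rewrite /live /= fgword_reduced.
pose g w := if live j w then modulus (coef w) else 0.
have gE w : live j w -> g w = modulus (coef w) by rewrite /g => ->.
have g0 w : 0 <= g w by rewrite /g; case: ifP => // _; rewrite modulus_ge0.
have gpush w : live j w -> forall k,
    modulus (coef (push (k, false) w)) = g (push (k, false) w).
  by move=> lw k; rewrite gE // live_push_neg.
have pos_eq i w : live j ((i, true) :: w) ->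
    l * coef ((i, true) :: w) =
    coef w + \sum_(k | k != i) coef [:: (k, false), (i, true) & w].
  move=> lw; rewrite coef_eigen // (bigD1 i) //= eqxx; congr (_ + _).
  apply: eq_bigr => k ki; rewrite -[inv_letter _]/(k, true) xpair_eqE andbT.
  by rewrite eq_sym (negPf ki).
have gsum i w : live j ((i, true) :: w) ->
    modulus (\sum_(k | k != i) coef [:: (k, false), (i, true) & w]) <=
    \sum_(k | k != i) g [:: (k, false), (i, true) & w].
  move=> lw; apply: le_trans (modulus_sum _ _) _; apply: ler_sum => k ki.
  rewrite gE // live_cons lw -[inv_letter _]/(k, true) xpair_eqE eqxx !andbT.
  by rewrite eq_sym ki.
suff : g s = 0.
  by rewrite gE // => /modulus_eq0; rewrite /coef valKd.
pose C := complex.Re (`|x| ^+ 2 * '[eta, eta]).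
apply: (@decay n R j g (modulus l) C n_gt1 (modulus_ge0 l)) => //.
- by move=> w /negPf dw'; rewrite /g dw'.
- move=> i w lw; rewrite gE // -modulusM coef_eigen //.
  apply: le_trans (modulus_sum _ _) _; apply: ler_sum => k _.
  rewrite gpush //= -[inv_letter _]/(k, true) xpair_eqE andbF.
  exact: lexx.
- move=> i w lw; rewrite gE // -modulusM pos_eq //.
  apply: le_trans (modulusD _ _) _; rewrite lerD ?gsum //.
  by rewrite gE // (live_behead lw).
- move=> i w lw; rewrite !gE ?(live_behead lw) // -modulusM.
  have -> : coef w = l * coef ((i, true) :: w) -
      \sum_(k | k != i) coef [:: (k, false), (i, true) & w].
    by rewrite pos_eq // addrK.
  by apply: le_trans (modulusB _ _) _; rewrite lerD ?gsum.
(* Square summability is Bessel's inequality for the tensors at distinct live words. *)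
move=> ss uss.
have etage0 : 0 <= '[eta, eta] by rewrite dnorm_ge0.
rewrite -lecR RRe_real; last by rewrite ger0_real // mulr_ge0 ?exprn_ge0.
have -> : (\sum_(w <- ss) g w ^+ 2)%:C =
    \sum_(w <- [seq w <- ss | live j w]) `|coef w| ^+ 2.
  rewrite rmorph_sum big_filter [RHS]big_mkcond; apply: eq_bigr => w _ /=.
  rewrite /g; case: ifP => _; first by rewrite rmorphXn /= modulusE.
  by rewrite expr0n.
apply: (Bessel x etage0); first exact: filter_uniq.
move=> u v; rewrite !mem_filter => /andP[du _] /andP[dv _].
have [s1 <- S1] := liveP du; have [s2 <- S2] := liveP dv.
by rewrite !valKd (tens_dot hH S1 S2 eta_in eta_in) val_eqE.
Qed.

End TensorPart.

(* An approximation [iota v + k] of [x], with [k] in the span of the tensors,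
   gets closer to [x] when [k], orthogonal to [x] and [iota v], is dropped. *)
Lemma orth_tens_closure (x : H) :
  (forall i s eta, Sminus i s -> Hprime V i eta -> '[x, tens s eta] = 0) ->
  closure (range iota) x.
Proof.
move=> xt.
pose A : set H := range iota `|` [set y | exists i s eta,
  [/\ Sminus i s, Hprime V i eta & y = tens s eta]].
pose P (w : H) := exists v k, [/\ w = iota v + k, '[x, k] = 0 &
  forall y, '[iota y, k] = 0].
have spanP w : lin_span A w -> P w.
  apply: lin_span_ind => {w}.
  - by exists 0, 0; split=> [||y]; rewrite ?linear0 ?addr0 ?hdot0r.
  - move=> _ _ [v [k [-> xk ik]]] [v' [k' [-> xk' ik']]].
    exists (v + v'), (k + k'); split=> [||y].
    + by rewrite linearD addrACA.
    + by rewrite hdotDr xk xk' addr0.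
    + by rewrite hdotDr ik ik' addr0.
  - move=> c w [[v _ <-]|[i [s [eta [Ss He ->]]]]].
      by exists (c *: v), 0; split=> [||y]; rewrite ?linearZ ?addr0 ?hdot0r.
    exists 0, (c *: tens s eta); split=> [||y];
      rewrite ?linear0 ?add0r // hdotZr.
      by rewrite (xt _ _ _ Ss He) mulr0.
    by rewrite hdotC (tens_iota hH y Ss He) rmorph0 mulr0.
have clx : closed_span A x.
  by rewrite (H_total hH : closed_span A = setT).
move=> B /nbhs_ballP[e /= e0 eB].
have [w /spanP[v [k [-> xk ik]]] xw] := closure_dist clx e0.
exists (iota v); split; first by exists v.
apply: eB; rewrite -ball_normE /=; apply: le_lt_trans xw.
have orth : '[x - iota v, k] = 0 by rewrite hdotBl xk ik subr0.
rewrite -(@ler_pXn2r _ 2) ?nnegrE // !hnormE opprD addrA.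
by rewrite (hnormBd orth) lerDl dnorm_ge0.
Qed.

(** * The closure of the copy of H_0 *)

Let D s := iota (Delta s).

(** Density is used twice: the range of [iota] in its closure, then the span of the [Delta s] in
    [H0]. *)
Lemma functional_closure_eq0 (F : H -> R[i]) (M : R[i]) (x : H) :
  {morph F : y z / y - z} -> 0 <= M -> (forall y, `|F y| <= M * `|y|) ->
  (forall c y, F (c *: y) = c * F y) ->
  (forall s, Gplus s -> F (D s) = 0) ->
  closure (range iota) x -> F x = 0.
Proof.
move=> FB M0 bF FZ FD; apply: (bounded_eq0 FB M0 bF) => _ [y _ <-].
have F0 : F 0 = 0 by rewrite -(subrr 0) FB subrr.
have FA u v : F (u + v) = F u + F v.
  have FN w : F (- w) = - F w by rewrite -sub0r FB F0 sub0r.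
  by rewrite -[v in LHS]opprK FB FN opprK.
apply: (@bounded_eq0 _ _ (F \o iota) M _
  (lin_span [set Delta s | s in @Gplus n])) => //=.
- by move=> u v /=; rewrite linearB FB.
- by move=> u; rewrite -(isometry_norm u (iota_isometry hH)).
- apply: lin_span_ind => [|u v u0 v0|c _ [s Gs <-]]; rewrite ?linear0 //.
    by rewrite linearD FA u0 v0 addr0.
  by rewrite linearZ FZ FD ?mulr0.
by have := Delta_total hH0; rewrite /closed_span => ->.
Qed.

Lemma D_dot s t : Gplus s -> Gplus t -> '[D t, D s] = (phi a (s^-1 * t)%g)%:C.
Proof. by move=> Gs Gt; rewrite (iota_isometry hH) (Delta_dot hH0). Qed.

Lemma U_D i s : Gplus s -> U i (D s) = D (gen i * s)%g.
Proof. by move=> Gs; rewrite (U_iota hU) (V_Delta hV). Qed.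

Lemma D_dot1 s : Gplus s -> '[D s, D 1%g] = (a ^+ size s)%:C.
Proof.
move=> Gs; rewrite D_dot //; last exact: Gplus_one.
by rewrite invg1 mul1g phi_pos.
Qed.

Lemma U_sum_D1 : \sum_i U i (D 1%g) = (n%:R * a)%:C *: D 1%g.
Proof.
have G1 := Gplus_one n; rewrite -linearZ -(Delta_sum hH0 G1) linear_sum.
by apply: eq_bigr => i _; rewrite U_D // mulg1 mul1g.
Qed.

(** Replaces identities between adjoints: both sides are bounded linear functionals of [z], so
    agreement on the [D s] suffices. *)
Lemma dot_U_eq i (u w z : H) (c : R[i]) :
  (forall s, Gplus s -> '[U i (D s), w] = c * '[D s, u]) ->
  closure (range iota) z -> '[U i z, w] = c * '[z, u].
Proof.
move=> hD clz; apply/eqP; rewrite -subr_eq0; apply/eqP.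
apply: (@functional_closure_eq0 (fun y => '[U i y, w] - c * '[y, u])
          (`|w| + `|c| * `|u|) z _ _ _ _ _ clz).
- by move=> y y'; rewrite linearB !hdotBl; ring.
- by rewrite addr_ge0 ?mulr_ge0.
- move=> y; apply: le_trans (ler_normB _ _) _; rewrite mulrDl lerD //.
    by rewrite mulrC -(isometry_norm y (@U_isometry i)) CauchySchwarz_hilbert.
  by rewrite normrM -mulrA ler_wpM2l // mulrC CauchySchwarz_hilbert.
- by move=> d y; rewrite linearZ !hdotZl; ring.
- by move=> s Gs; rewrite hD // subrr.
Qed.

Lemma dot_U_D1 i (z : H) :
  closure (range iota) z -> '[U i z, D 1%g] = a%:C * '[z, D 1%g].
Proof.
apply: dot_U_eq => s Gs; have Gis := Gplus_mul (Gplus_gen i) Gs.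
by rewrite U_D // !D_dot1 // gen_mul_word //= exprS rmorphM.
Qed.

(** This is V_i^* V_k = b <., Delta_1> Delta_1 tested against Delta_s; on [D t] it is [phi_peak]. *)
Lemma dot_U_neq i k s (z : H) : i != k -> Gplus s -> closure (range iota) z ->
  '[U k z, U i (D s)] = (b * a ^+ size s)%:C * '[z, D 1%g].
Proof.
move=> ik Gs; apply: dot_U_eq => t Gt.
have Gis := Gplus_mul (Gplus_gen i) Gs; have Gkt := Gplus_mul (Gplus_gen k) Gt.
rewrite !U_D // D_dot // phi_peak // D_dot1 // -rmorphM exprD.
by congr (_%:C); ring.
Qed.

Lemma eigen_closure (x : H) l : \sum_i U i x = l *: x -> closure (range iota) x.
Proof.
move=> hx; apply: orth_tens_closure => i s eta Ss He.
exact: coef_eq0 hx i eta He s Ss.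
Qed.

Lemma eigen_orth_eq0 (z : H) l :
  \sum_i U i z = l *: z -> '[z, D 1%g] = 0 -> z = 0.
Proof.
move=> hz z1; have clz := eigen_closure hz.
have step i s : Gplus s -> l * '[z, D (gen i * s)%g] = '[z, D s].
  move=> Gs; rewrite -hdotZl -hz hdot_suml (bigD1 i) //= -U_D // U_isometry.
  rewrite big1 ?addr0 // => k ki.
  by rewrite dot_U_neq // 1?eq_sym // z1 mulr0.
have zD s : Gplus s -> '[z, D s] = 0.
  (* For [l = 0], [step] with any one generator gives the claim at once; otherwise it propagates the
     vanishing from [D 1]. *)
  have [l0|l0] := eqVneq l 0.
    move=> Gs; rewrite -(step (Ordinal (ltnW n_gt1)) s Gs) l0 mul0r //.
  elim/Gplus_ind_left => // i t Gt zt; apply: (mulfI l0).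
  by rewrite step // zt mulr0.
apply: hdot_eq0.
apply: (@functional_closure_eq0 (fun y => '[y, z]) `|z| z _ _ _ _ _ clz) => //.
- by move=> u v; rewrite hdotBl.
- by move=> y; rewrite mulrC CauchySchwarz_hilbert.
- by move=> c y; rewrite hdotZl.
- by move=> s Gs; rewrite hdotC zD // rmorph0.
Qed.

Lemma D1_norm : '[D 1%g, D 1%g] = 1.
Proof. by rewrite D_dot1 //; exact: Gplus_one. Qed.

Lemma D1_neq0 : D 1%g != 0.
Proof. by rewrite -(dnorm_eq0 (hdot H)) D1_norm oner_eq0. Qed.

(** Pairing the equation with [D 1] gives [l = n * a] or [c = 0]. In either case [x - c *: D 1]
    satisfies the equation for [l] and is orthogonal to [D 1]. *)
Lemma eigen_scalar (x : H) l : \sum_i U i x = l *: x ->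
  x = '[x, D 1%g] *: D 1%g.
Proof.
move=> hx; set c := '[x, _].
have hc : (l - (n%:R * a)%:C) * c = 0.
  rewrite mulrBl -{1}/c -hdotZl -hx hdot_suml.
  under eq_bigr do rewrite (dot_U_D1 _ (eigen_closure hx)).
  have -> : (n%:R * a)%:C = n%:R * a%:C by rewrite rmorphM /= rmorph_nat.
  by rewrite sumr_const card_ord -/c -mulrA mulr_natl subrr.
apply/eqP; rewrite -subr_eq0; apply/eqP; apply: (@eigen_orth_eq0 _ l).
  under eq_bigr do rewrite linearB linearZ.
  rewrite sumrB hx -scaler_sumr U_sum_D1 scalerBr; congr (_ - _).
  rewrite !scalerA; congr (_ *: _).
  by move: hc; rewrite mulrBl => /subr0_eq ->; rewrite mulrC.
by rewrite hdotBl hdotZl D1_norm mulr1 subrr.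
Qed.

End Eigen.

Theorem proposition2p4 (R : realType) (n : nat) (a : R)
  (hn : (2 <= n)%N) (ha0 : 0 < a) (ha1 : a <= 1)
  (H0 : hilbert R) (Delta : freegroup n -> H0) (hH0 : is_H0 a Delta)
  (V : 'I_n -> {linear H0 -> H0}) (hV : is_V Delta V)
  (H : hilbert R) (iota : {linear H0 -> H}) (tens : freegroup n -> H0 -> H)
  (hH : is_H V iota tens)
  (U : 'I_n -> {linear H -> H}) (hU : is_U V iota tens U)
  (pi : freegroup n -> {linear H -> H}) (hpi : unitary_rep pi)
  (hpiU : forall i x, pi (gen i) x = U i x) :
  let T := fun x : H => \sum_(i < n) pi (gen i) x in
  (forall l : R[i], is_eigenvalue T l <-> l = (n%:R * a)%:C) /\
  eigenspace_of T (n%:R * a)%:C = [set c *: iota (Delta 1%g) | c in [set: R[i]]].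
Proof.
move=> T.
have TE x : T x = \sum_i U i x by apply: eq_bigr => i _; rewrite hpiU.
have T1 : T (iota (Delta 1%g)) = (n%:R * a)%:C *: iota (Delta 1%g).
  by rewrite TE (U_sum_D1 hH0 hV hU).
have D10 := D1_neq0 hH0 hH.
have scal x l : T x = l *: x -> x = '[x, iota (Delta 1%g)] *: iota (Delta 1%g).
  by rewrite TE; apply: eigen_scalar hn hH0 hV hH hU x l.
have TZ c :
    T (c *: iota (Delta 1%g)) = (n%:R * a)%:C *: (c *: iota (Delta 1%g)).
  rewrite scalerA mulrC -scalerA -T1 TE scaler_sumr.
  by apply: eq_bigr => i _; rewrite linearZ hpiU.
split=> [l|]; last first.
  apply/seteqP; split=> [x /scal ->|_ [c _ <-]]; last exact: TZ.
  by exists '[x, iota (Delta 1%g)].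
split=> [[x x0 hx]|->]; last by exists (iota (Delta 1%g)).
(* As a multiple of Delta_1, [x] also has eigenvalue [n * a]; being nonzero, it has only one. *)
have xE := scal _ _ hx; move: (TZ '[x, iota (Delta 1%g)]); rewrite -xE hx.
move/eqP; rewrite -subr_eq0 -scalerBl scaler_eq0 (negPf x0) orbF subr_eq0.
by move/eqP.
Qed.
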